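(* Let $M\in\mathbb{N}$ be even, $M\ge2$, and $n=M/2$. The extended Gramian closure $\mathcal{C}:\mathcal{R}\to\mathbb{R}$ for even $M$, $$u_{2n+1}=\mathcal{C}(u_0,\dots,u_{2n})=u_{n+1,2n}^{T}G_{n-1}^{-1}u_{n,2n-1}+\chi\,\frac{\sigma_{n,n}}{\sigma_{n-1,n-1}}\,\sigma_{n-1,n},$$ with the choice $\chi=\frac{n+1}{n}$ is gauge-invariant.
   Context: Realizable moments: $\mathcal{R}\subset\mathbb{R}^{M+1}$ is the set of vectors $(u_0,\dots,u_M)$ with $u_k=\int_{\mathbb{R}}c^kf(c)\,dc$ for some measurable $f:\mathbb{R}\to[0,\infty)$, not almost everywhere zero, with finite moments up to order $M$. Gramian matrix: $G_k=(u_{i+j})_{i,j=0,\dots,k}\in\mathbb{R}^{(k+1)\times(k+1)}$; it is symmetric positive definite for $2k\le M$ and realizable moments. For $k\le l$, $u_{k,l}=(u_k,u_{k+1},\dots,u_l)^T$. Terms involving the empty matrix $G_{-1}$ are zero. For $k\ge0$, $$\sigma_{k,k}=u_{2k}-u_{k,2k-1}^TG_{k-1}^{-1}u_{k,2k-1},\qquad \sigma_{k,k+1}=u_{2k+1}-u_{k+1,2k}^TG_{k-1}^{-1}u_{k,2k-1}.$$ Gauge transformation: for $\rho,\theta>0$ and $v\in\mathbb{R}$, the transformed moments are $$\widetilde u_k=\frac{1}{\rho\,\theta^{k/2}}\sum_{j=0}^{k}\binom{k}{j}v^ju_{k-j},\qquad k=0,\dots,M+1$$ (the moments of $g(\widetilde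 c)=\rho^{-1}\theta^{1/2}f(\theta^{1/2}\widetilde c-v)$; in particular $\mathcal{R}$ is mapped to itself). Gauge-invariance: $\mathcal{C}$ is gauge-invariant if for all $\rho,\theta>0$, $v\in\mathbb{R}$, all $(u_0,\dots,u_M)\in\mathcal{R}$ and all $u_{M+1}\in\mathbb{R}$, $$\widetilde u_{M+1}=\mathcal{C}(\widetilde u_0,\dots,\widetilde u_M)\iff u_{M+1}=\mathcal{C}(u_0,\dots,u_M).$$ *)

(* Defs.v *)
From mathcomp Require Import all_boot all_order all_algebra.
From mathcomp Require Import all_classical all_reals all_analysis.
Set Implicit Arguments.
Unset Strict Implicit.
Unset Printing Implicit Defensive.
Import Order.TTheory GRing.Theory Num.Theory.
Import numFieldNormedType.Exports.
Local Open Scope classical_set_scope.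
Local Open Scope ring_scope.

(* Moment vectors (u_0, ..., u_M) are row vectors of length M.+1. *)

Definition realizable (R : realType) (M : nat) (u : 'rV[R]_M.+1) : Prop :=
  exists f : R -> R,
    [/\ measurable_fun setT f,
        forall c, 0 <= f c,
        ~ {ae @lebesgue_measure R, forall c, f c = 0},
        forall k : 'I_M.+1,
          (@lebesgue_measure R).-integrable setT
            (fun c => (c ^+ k * f c)%:E) &
        forall k : 'I_M.+1,
          u 0 k = \int[@lebesgue_measure R]_(c in setT) (c ^+ k * f c)].

(* u_k as a function of a natural number k; the value 0 for k >= m is junk,
   never read by the closure or by the gauge transformation below. *)
Definition mom (R : realType) (m : nat) (u : 'rV[R]_m) (k : nat) : R :=
  oapp (u 0) 0 (insub k).

(* [gramian u k] is G_{k-1}, of size k; [gramian u 0] is the empty matrix, and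
   the products below that involve it are 0. *)
Definition gramian (R : realType) (m : nat) (u : 'rV[R]_m) (k : nat) : 'M[R]_k :=
  \matrix_(i < k, j < k) mom u (i + j).

(* [momcol u k d] is u_{k,k+d-1}, a column of length d. *)
Definition momcol (R : realType) (m : nat) (u : 'rV[R]_m) (k d : nat) : 'cV[R]_d :=
  \col_(i < d) mom u (k + i).

(* [gramform u l k] is u_{l,l+k-1}^T G_{k-1}^{-1} u_{k,2k-1}. *)
Definition gramform (R : realType) (m : nat) (u : 'rV[R]_m) (l k : nat) : R :=
  ((momcol u l k)^T *m invmx (gramian u k) *m momcol u k k) 0 0.

(* sigma_{k,k} *)
Definition sigma0 (R : realType) (m : nat) (u : 'rV[R]_m) (k : nat) : R :=
  mom u (2 * k) - gramform u k k.

(* sigma_{k,k+1} *)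
Definition sigma1 (R : realType) (m : nat) (u : 'rV[R]_m) (k : nat) : R :=
  mom u (2 * k).+1 - gramform u k.+1 k.

(* Total on row vectors; its values matter only on realizable ones, where the
   Gramian is invertible and sigma_{n-1,n-1} <> 0. *)
Definition ext_gramian_closure (R : realType) (M : nat) (chi : R)
    (u : 'rV[R]_M.+1) : R :=
  let n := M./2 in
  gramform u n.+1 n + chi * (sigma0 u n / sigma0 u n.-1) * sigma1 u n.-1.

Definition gauge (R : realType) (rho theta v : R) (m : nat) (u : 'rV[R]_m) :
    'rV[R]_m :=
  \row_(k < m) ((rho * theta `^ (k%:R / 2))^-1 *
    \sum_(j < k.+1) 'C(k, j)%:R * v ^+ j * mom u (k - j)).

(* [w] is (u_0, ..., u_M, u_{M+1}); [lsubmx] and [rsubmx] recover the first M+1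
   entries and the last one. *)
Definition gauge_invariant (R : realType) (M : nat) (C : 'rV[R]_M.+1 -> R) : Prop :=
  forall rho theta v : R, 0 < rho -> 0 < theta ->
  forall u : 'rV[R]_M.+1, realizable u -> forall uM1 : R,
    let w : 'rV[R]_(M.+1 + 1) := row_mx u (const_mx uM1) in
    let w' := gauge rho theta v w in
    rsubmx w' 0 0 = C (lsubmx w') <-> uM1 = C u.

(* Main.v *)
Require Import Defs.
From HB Require Import structures.
From mathcomp Require Import all_boot all_order all_algebra.
From mathcomp Require Import all_classical all_reals all_analysis.
From mathcomp Require Import finmap measurable_realfun zify ring.
Import Order.TTheory GRing.Theory Num.Theory.
Import numFieldNormedType.Exports.
Set Implicit Arguments.
Unset Strict Implicit.
Unset Printing Implicit Defensive.
Local Open Scope ring_scope.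

(* Let L be the linear form on polynomials with L(X^k) = u_k, and p_k the monic
   polynomial of degree k orthogonal to all lower degrees.  Then
   sigma_{k,k} = L(X^k p_k) and sigma_{k,k+1} = L(X^{k+1} p_k), and the closure
   reads sigma_{n,n+1} = chi sigma_{n,n} / sigma_{n-1,n-1} sigma_{n-1,n}.
   Writing a = theta^{-1/2}, a gauge transformation replaces L(p) by
   rho^{-1} L(p(a(X + v))), whose orthogonal polynomials are a^k p_k(X/a - v).
   Hence sigma_{k,k} is multiplied by rho^{-1} a^{2k}, while sigma_{k,k+1}
   becomes rho^{-1} a^{2k+1} (sigma_{k,k+1} + (k+1) v sigma_{k,k}).  The terms
   in v cancel from the closure relation exactly when chi n = n + 1. *)

(** * The linear form attached to a moment vector *)

(** The form [L] of the outline. Dropping the degrees from [m] on agrees with the default value 0 of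
    [mom]. *)
Definition riesz (R : realType) (m : nat) (u : 'rV[R]_m) (p : {poly R}) : R :=
  \sum_(i < m) p`_i * u 0 i.

Lemma riesz_is_scalar (R : realType) (m : nat) (u : 'rV[R]_m) :
  scalar (riesz u).
Proof.
move=> a p q; rewrite /riesz mulr_sumr -big_split /=; apply: eq_bigr => i _.
by rewrite coefD coefZ mulrDl mulrA.
Qed.

HB.instance Definition _ (R : realType) (m : nat) (u : 'rV[R]_m) :=
  GRing.isLinear.Build R {poly R} R *%R (riesz u) (riesz_is_scalar u).

Lemma rieszZ (R : realType) (m : nat) (u : 'rV[R]_m) a p :
  riesz u (a *: p) = a * riesz u p.
Proof. exact: linearZ. Qed.

Lemma riesz_Xn (R : realType) (m : nat) (u : 'rV[R]_m) k :
  riesz u 'X^k = mom u k.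
Proof.
rewrite /riesz /mom; case: insubP => [i _ <-|km] /=.
  rewrite (bigD1 i) //= coefXn eqxx mul1r big1 ?addr0 // => j /negPf ji.
  by rewrite coefXn -[_ == _]/(j == i) ji mul0r.
rewrite big1 // => i _; rewrite coefXn.
by case: eqP km => [<-|_ _]; [rewrite ltn_ord | rewrite mul0r].
Qed.

Lemma riesz_row_mx (R : realType) (m l : nat) (u : 'rV[R]_m) (t : 'rV[R]_l)
    (p : {poly R}) :
  (size p <= m)%N -> riesz (row_mx u t) p = riesz u p.
Proof.
move=> pm; rewrite /riesz big_split_ord /= [X in _ + X]big1 ?addr0 => [|i _].
  by apply: eq_bigr => i _; rewrite row_mxEl.
by rewrite nth_default ?mul0r // (leq_trans pm) ?leq_addr.
Qed.

Lemma mom_ord (R : realType) (m : nat) (u : 'rV[R]_m) (i : 'I_m) :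
  mom u i = u 0 i.
Proof. by rewrite /mom valK. Qed.

Lemma mom_lsubmx (R : realType) (m l : nat) (w : 'rV[R]_(m + l)) k :
  (k < m)%N -> mom (lsubmx w) k = mom w k.
Proof.
by move=> km; rewrite -[k]/(val (Ordinal km)) mom_ord mxE -mom_ord.
Qed.

(** Serves to pass from [lsubmx w], on which the closure is evaluated, to the full vector [w]. *)
Lemma eq_gramform (R : realType) (m m' : nat) (u : 'rV[R]_m) (u' : 'rV[R]_m')
    (l k : nat) :
  (k <= l)%N -> (forall i, (i < l + k)%N -> mom u i = mom u' i) ->
  gramform u l k = gramform u' l k.
Proof.
move=> kl uu'; rewrite /gramform.
have momcolE d : (d <= l)%N -> momcol u d k = momcol u' d k.
  by move=> dl; apply/colP => i; rewrite !mxE uu' //; have := ltn_ord i; lia.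
rewrite !momcolE //; congr ((_ *m invmx _ *m _) 0 0).
apply/matrixP => i j; rewrite !mxE uu' //.
have := ltn_ord i; have := ltn_ord j; lia.
Qed.

(** * Monic orthogonal polynomials and the Gramian *)

(* The size condition says that p is monic of degree k. *)
Definition orthopoly (R : realType) (m : nat) (u : 'rV[R]_m) (k : nat)
    (p : {poly R}) : Prop :=
  (size (p - 'X^k)%R <= k)%N /\ forall i, (i < k)%N -> riesz u (p * 'X^i) = 0.

Lemma size_orthopoly (R : realType) (m : nat) (u : 'rV[R]_m) k p :
  orthopoly u k p -> size p = k.+1.
Proof.
by case=> sp _; rewrite -(subrK 'X^k p) addrC size_polyDl ?size_polyXn.
Qed.

Lemma riesz_orthopoly_small (R : realType) (m : nat) (u : 'rV[R]_m) (k : nat)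
    (p r : {poly R}) :
  orthopoly u k p -> (size r <= k)%N -> riesz u (p * r) = 0.
Proof.
move=> [_ po] rk; rewrite -[r]coefK poly_def mulr_sumr linear_sum.
rewrite big1 //= => i _.
by rewrite -scalerAr rieszZ po ?mulr0 // (leq_trans _ rk).
Qed.

Lemma riesz_rVpolyXn (R : realType) (m : nat) (u : 'rV[R]_m) k
    (v : 'rV[R]_k) i :
  riesz u (rVpoly v * 'X^i) = (v *m momcol u i k) 0 0.
Proof.
rewrite -[rVpoly v]coefK poly_def mulr_suml linear_sum /=.
(* The size of [rVpoly v] may be below [k]; the sum is extended to [k] by zero coefficients. *)
rewrite (big_ord_widen k (fun j => riesz u ((rVpoly v)`_j *: 'X^j * 'X^i)));
  last exact: size_poly.
rewrite big_mkcond mxE; apply: eq_bigr => j _ /=.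
rewrite -scalerAl -exprD rieszZ riesz_Xn coef_rVpoly_ord !mxE addnC.
case: ifPn => // /negPf; rewrite ltnNge => /negbFE jv.
by rewrite -coef_rVpoly_ord nth_default ?mul0r.
Qed.

Lemma tr_gramian (R : realType) (m : nat) (u : 'rV[R]_m) k :
  (gramian u k)^T = gramian u k.
Proof. by apply/matrixP => i j; rewrite !mxE addnC. Qed.

Lemma mul_gramianE (R : realType) (m : nat) (u : 'rV[R]_m) k (v : 'rV[R]_k) i :
  (v *m gramian u k) 0 i = riesz u (rVpoly v * 'X^i).
Proof.
by rewrite riesz_rVpolyXn !mxE; apply: eq_bigr => j _; rewrite !mxE addnC.
Qed.

(** By symmetry of the Gramian, its inverse can be moved onto [momcol u k k]. When the Gramian is
    invertible, the resulting row holds the coefficients of the orthogonal projection of [X^k] onto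
    degrees below [k]. *)
Lemma gramformE (R : realType) (m : nat) (u : 'rV[R]_m) l k :
  gramform u l k =
  riesz u (rVpoly ((momcol u k k)^T *m invmx (gramian u k)) * 'X^l).
Proof.
rewrite /gramform riesz_rVpolyXn.
set A : 'M[R]_1 := (momcol u l k)^T *m _ *m _.
transitivity (A^T 0 0); first by rewrite [RHS]mxE.
by rewrite /A !trmx_mul trmx_inv tr_gramian trmxK mulmxA.
Qed.

(** Orthogonality of [p] is a linear system for the coefficients of [X^k - p]; its only solution is
    the row of [gramformE]. *)
Lemma riesz_orthopoly (R : realType) (m : nat) (u : 'rV[R]_m) k p l :
  gramian u k \in unitmx -> orthopoly u k p ->
  riesz u (p * 'X^l) = mom u (l + k) - gramform u l k.
Proof.
move=> Gu [sp po]; pose c : 'rV_k := poly_rV ('X^k - p).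
have cE : rVpoly c = 'X^k - p by rewrite poly_rV_K // -opprB size_polyN.
have cG : c *m gramian u k = (momcol u k k)^T.
  apply/rowP => i; rewrite mul_gramianE cE mulrBl linearB /= po // subr0.
  by rewrite -exprD riesz_Xn !mxE.
rewrite gramformE -cG mulmxK // cE mulrBl linearB /= -exprD riesz_Xn addnC.
by rewrite subKr.
Qed.

(** The witness is [X^k] minus its projection onto lower degrees. *)
Lemma orthopoly_exists (R : realType) (m : nat) (u : 'rV[R]_m) k :
  gramian u k \in unitmx -> exists p, orthopoly u k p.
Proof.
move=> Gu; set c := (momcol u k k)^T *m invmx (gramian u k).
exists ('X^k - rVpoly c); split=> [|i ik].
  by rewrite addrC addKr size_polyN size_poly.
rewrite mulrBl linearB /= -[i]/(val (Ordinal ik)) -mul_gramianE mulmxKV //.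
by rewrite -exprD riesz_Xn !mxE subrr.
Qed.

(** * Positive definiteness *)

(** Positive definiteness of the Gramian of size [k], phrased on polynomials so that it passes
    through substitutions. *)
Definition riesz_pos (R : realType) (m : nat) (u : 'rV[R]_m) (k : nat) : Prop :=
  forall q : {poly R}, q != 0 -> (size q <= k)%N -> 0 < riesz u (q * q).

(** A row [v] killed by the Gramian is orthogonal to all degrees below [k], hence to itself. *)
Lemma gramian_unit (R : realType) (m : nat) (u : 'rV[R]_m) k :
  riesz_pos u k -> gramian u k \in unitmx.
Proof.
move=> up; rewrite -row_free_unit; apply: inj_row_free => v vG.
apply/eqP; rewrite -(inj_eq (can_inj rVpolyK)) linear0; apply: contraT => v0.
have := up _ v0 (size_poly _ _).
rewrite -[X in _ * X]coefK poly_def mulr_sumr linear_sum big1 ?ltxx //= => i _.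
have ik : (i < k)%N by rewrite (leq_trans (ltn_ord i)) ?size_poly.
rewrite -scalerAr rieszZ -[X in 'X^X]/(val (Ordinal ik)) -mul_gramianE vG.
by rewrite mxE mulr0.
Qed.

Lemma riesz_posW (R : realType) (m : nat) (u : 'rV[R]_m) k l :
  (k <= l)%N -> riesz_pos u l -> riesz_pos u k.
Proof. by move=> kl up q q0 qk; apply: up q0 (leq_trans qk kl). Qed.

Lemma sigma0_orthopoly (R : realType) (m : nat) (u : 'rV[R]_m) k p :
  gramian u k \in unitmx -> orthopoly u k p -> sigma0 u k = riesz u (p * 'X^k).
Proof.
by move=> Gu po; rewrite (riesz_orthopoly _ Gu po) /sigma0 mul2n addnn.
Qed.

Lemma sigma1_orthopoly (R : realType) (m : nat) (u : 'rV[R]_m) k p :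
  gramian u k \in unitmx -> orthopoly u k p ->
  sigma1 u k = riesz u (p * 'X^(k.+1)).
Proof.
by move=> Gu po; rewrite (riesz_orthopoly _ Gu po) /sigma1 mul2n addSn addnn.
Qed.

(** Since [p - X^k] has lower degree, [L(p X^k) = L(p p)]. *)
Lemma sigma0_gt0 (R : realType) (m : nat) (u : 'rV[R]_m) k :
  riesz_pos u k.+1 -> 0 < sigma0 u k.
Proof.
move=> up; have Gu := gramian_unit (riesz_posW (leqnSn k) up).
have [p po] := orthopoly_exists Gu; have sp := size_orthopoly po.
rewrite (sigma0_orthopoly Gu po).
have -> : riesz u (p * 'X^k) = riesz u (p * p).
  rewrite -[X in _ = riesz u (_ * X)](subrK 'X^k) mulrDr linearD /=.
  by rewrite [X in X + _](riesz_orthopoly_small po) ?add0r //; case: po.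
by apply: up; rewrite -?size_poly_eq0 sp.
Qed.

(* Only the two leading terms matter against a polynomial orthogonal to all
   lower degrees. *)
Lemma expXDC (R : realType) (c : R) k :
  exists2 r : {poly R}, (size r <= k)%N &
    ('X + c%:P) ^+ k.+1 = 'X^(k.+1) + (k.+1%:R * c) *: 'X^k + r.
Proof.
elim: k => [|k [r rk IH]].
  by exists 0; rewrite ?size_poly0 // !expr1 expr0 mul1r addr0 alg_polyC.
exists ((k.+1%:R * c ^+ 2) *: 'X^k + ('X + c%:P) * r).
  rewrite (leq_trans (size_polyD _ _)) // geq_max; apply/andP; split.
    by rewrite (leq_trans (size_scale_leq _ _)) // size_polyXn.
  rewrite (leq_trans (size_polyMleq _ _)) // size_XaddC; lia.
rewrite exprS IH -!mul_polyC -natr1 !polyCM polyCD polyC1 -natr1.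
rewrite !(polyCD,polyCM,polyC1,polyC_exp,exprS).
ring.
Qed.

(** * Positivity for realizable moments *)

Lemma finite_set_root (R : realType) (q : {poly R}) :
  q != 0 -> finite_set [set c | root q c]%classic.
Proof.
move=> q0; apply: contrapT => /(infinite_set_fset (size q))[B Bq].
apply/negP; rewrite -ltnNge; apply: max_poly_roots => //.
  by apply/allP => c cB; apply: Bq.
by rewrite fset_uniq.
Qed.

Lemma riesz_integral (R : realType) (M : nat) (u : 'rV[R]_M.+1) (f : R -> R)
    (p : {poly R}) :
  (forall k : 'I_M.+1, (@lebesgue_measure R).-integrable setT
     (fun c => (c ^+ k * f c)%:E)) ->
  (forall k : 'I_M.+1,
     u 0 k = \int[@lebesgue_measure R]_(c in setT) (c ^+ k * f c)) ->
  (size p <= M.+1)%N ->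
  (riesz u p)%:E = (\int[@lebesgue_measure R]_c (p.[c] * f c)%:E)%E.
Proof.
move=> fi uE pM.
under eq_integral => c _.
  rewrite (horner_coef_wide _ pM) mulr_suml -sumEFin.
  under eq_bigr do rewrite -mulrA EFinM.
  over.
rewrite integral_sum //; last by move=> i; apply: integrableZl.
rewrite /riesz -sumEFin; apply: eq_bigr => i _.
rewrite integralZl // EFinM uE /Rintegral fineK //.
exact: integrable_fin_num.
Qed.

(** [L(q q)] is the integral of [q^2 f], hence nonnegative. If it vanished, [q^2 f] would be 0
    almost everywhere, and so would [f], as [q] has finitely many roots. The bound on [k] keeps the
    degree of [q^2] at most [M]. *)
Lemma realizable_riesz_pos (R : realType) (M k : nat) (u : 'rV[R]_M.+1) :
  realizable u -> (k.*2 <= M.+2)%N -> riesz_pos u k.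
Proof.
case=> f [mf f0 fn0 fi uE] kM q q0 qk.
have sqq : (size (q * q)%R <= M.+1)%N.
  by rewrite (leq_trans (size_polyMleq _ _)) //; rewrite -addnn in kM; lia.
have qf0 c : 0 <= (q * q).[c] * f c by rewrite hornerM -expr2 mulr_ge0 ?sqr_ge0.
rewrite lt_neqAle; apply/andP; split; last first.
  rewrite -lee_fin (riesz_integral fi uE) //.
  by apply: integral_ge0 => c _; rewrite lee_fin.
apply/negP => /eqP /esym r0; apply: fn0.
have mqf : measurable_fun [set: R] (fun c => (q * q).[c] * f c).
  by apply: measurable_funM => //; exact: measurable_poly.
have [ae0 _] :=
  ae_eq_integral_abs (@lebesgue_measure R) measurableT
    ((measurable_EFinP _ _).2 mqf).
have {}ae0 : ae_eq (@lebesgue_measure R) setT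
    (fun c => ((q * q).[c] * f c)%:E) (cst 0%E).
  apply: ae0; under eq_integral do rewrite abse_EFin ger0_norm //.
  by rewrite -(riesz_integral fi uE sqq) r0.
have rq0 : (@lebesgue_measure R).-negligible [set c | root q c]%classic.
  have fq := finite_set_root q0.
  apply/negligibleP.
    apply: countable_measurable => [t|]; first exact: measurable_set1.
    exact: finite_set_countable.
  exact/countable_lebesgue_measure0/finite_set_countable.
apply: negligibleS (negligibleU ae0 rq0) => c /= fc.
have [qc|qc] := boolP (root q c); [by right|left].
apply/not_implyP; split => // -[] /eqP.
by rewrite hornerM !mulf_eq0 -!rootE (negPf qc) => /eqP.
Qed.

(** * The gauge transformation as a substitution *)

Definition gauge_scale (R : realType) (theta : R) : R := (theta `^ 2^-1)^-1.

Lemma gauge_scale_gt0 (R : realType) (theta : R) :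
  0 < theta -> 0 < gauge_scale theta.
Proof. by move=> t0; rewrite invr_gt0 powR_gt0. Qed.

Lemma gauge_scaleX (R : realType) (theta : R) k :
  0 < theta -> (theta `^ (k%:R / 2))^-1 = gauge_scale theta ^+ k.
Proof.
move=> t0; rewrite mulrC powRrM powR_mulrn ?powR_ge0 //.
by rewrite /gauge_scale exprVn.
Qed.

Definition gauge_poly (R : realType) (theta v : R) : {poly R} :=
  gauge_scale theta *: ('X + v%:P).

(** The sum defining [gauge] is the binomial expansion of [L((X + v)^k)]. *)
Lemma mom_gauge (R : realType) (rho theta v : R) m (w : 'rV[R]_m) k :
  0 < theta -> (k < m)%N ->
  mom (gauge rho theta v w) k = rho^-1 * riesz w (gauge_poly theta v ^+ k).
Proof.
move=> t0 km; have -> := mom_ord (gauge rho theta v w) (Ordinal km).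
rewrite mxE /= invfM gauge_scaleX // -mulrA; congr (_ * _).
rewrite /gauge_poly exprZn rieszZ exprDn linear_sum; congr (_ * _) => /=.
apply: eq_bigr => j _.
rewrite -polyC_exp [in RHS]mulrC mul_polyC linearMn /= rieszZ riesz_Xn.
by rewrite -mulrA mulr_natl.
Qed.

Lemma riesz_gauge (R : realType) (rho theta v : R) m (w : 'rV[R]_m)
    (p : {poly R}) :
  0 < theta -> (size p <= m)%N ->
  riesz (gauge rho theta v w) p = rho^-1 * riesz w (p \Po gauge_poly theta v).
Proof.
move=> t0 pm; rewrite comp_polyE -[in LHS](coefK p) poly_def.
rewrite !linear_sum mulr_sumr.
apply: eq_bigr => i _ /=; rewrite !rieszZ riesz_Xn mom_gauge //; last first.
  exact: leq_trans pm.
by rewrite mulrCA.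
Qed.

Lemma size_gauge_poly (R : realType) (theta v : R) :
  0 < theta -> size (gauge_poly theta v) = 2.
Proof.
by move=> t0; rewrite size_scale ?size_XaddC // gt_eqF ?gauge_scale_gt0.
Qed.

(** Substituting a polynomial of degree one preserves degrees and nonzero polynomials. *)
Lemma riesz_pos_gauge (R : realType) (rho theta v : R) m (w : 'rV[R]_m) k :
  0 < rho -> 0 < theta -> (k.*2 <= m.+1)%N -> riesz_pos w k ->
  riesz_pos (gauge rho theta v w) k.
Proof.
move=> r0 t0 km wp q q0 qk; rewrite riesz_gauge //; last first.
  rewrite (leq_trans (size_polyMleq _ _)) //.
  by rewrite -addnn in km; lia.
have sg := size_gauge_poly v t0.
rewrite mulr_gt0 ?invr_gt0 // comp_polyM; apply: wp.
  by rewrite -size_poly_eq0 size_comp_poly2 // size_poly_eq0.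
by rewrite size_comp_poly2.
Qed.

Lemma size_XsubC_expB (R : realType) (c : R) k :
  (size (('X - c%:P) ^+ k - 'X^k)%R <= k)%N.
Proof.
case: k => [|k]; first by rewrite !expr0 subrr size_poly0.
have [r rk] := expXDC (- c) k; rewrite polyCN => ->.
rewrite -(addrA 'X^_) addrAC subrr add0r.
rewrite (leq_trans (size_polyD _ _)) // geq_max.
by rewrite (leq_trans rk) // (leq_trans (size_scale_leq _ _)) // size_polyXn.
Qed.

(** * Orthogonal polynomials under gauge transformation *)

(** Composition with the inverse of [gauge_poly]; the factor [a^k] makes the result monic again. *)
Definition gauge_orthopoly (R : realType) (theta v : R) (k : nat)
    (p : {poly R}) : {poly R} :=
  gauge_scale theta ^+ k *: (p \Po ((gauge_scale theta)^-1 *: 'X - v%:P)).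

Lemma gauge_orthopolyK (R : realType) (theta v : R) k (p : {poly R}) :
  0 < theta -> gauge_orthopoly theta v k p \Po gauge_poly theta v =
               gauge_scale theta ^+ k *: p.
Proof.
move=> t0; rewrite /gauge_orthopoly comp_polyZ -comp_polyA comp_polyB.
rewrite comp_polyZ comp_polyX comp_polyC scalerA mulVf ?gt_eqF ?gauge_scale_gt0 //.
by rewrite scale1r addrK comp_polyXr.
Qed.

Lemma size_gauge_orthopoly (R : realType) (theta v : R) k (p : {poly R}) :
  0 < theta -> (size (p - 'X^k)%R <= k)%N ->
  (size (gauge_orthopoly theta v k p - 'X^k)%R <= k)%N.
Proof.
move=> t0 pk; set a := gauge_scale theta.
have a0 : a != 0 by rewrite gt_eqF ?gauge_scale_gt0.
have lin : a *: (a^-1 *: 'X - v%:P) = 'X - (a * v)%:P.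
  by rewrite scalerBr scalerA divff // scale1r -mul_polyC -polyCM.
(* Split [p] as [(p - X^k) + X^k]: the second summand becomes [(X - a v)^k], whose leading term
   cancels [X^k]. *)
have -> : gauge_orthopoly theta v k p - 'X^k =
    a ^+ k *: ((p - 'X^k) \Po (a^-1 *: 'X - v%:P))
    + (('X - (a * v)%:P) ^+ k - 'X^k).
  by rewrite comp_polyB comp_Xn_poly scalerBr -exprZn lin addrA subrK.
rewrite (leq_trans (size_polyD _ _)) // geq_max size_XsubC_expB andbT.
rewrite (leq_trans (size_scale_leq _ _)) // size_comp_poly2 //.
have av0 : a^-1 != 0 by rewrite invr_eq0.
rewrite -polyCN size_polyDl size_scale ?size_polyX //.
by rewrite (leq_ltn_trans (size_polyC_leq1 (- v))).
Qed.

Lemma riesz_gauge_orthopoly (R : realType) (rho theta v : R) m (w : 'rV[R]_m)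
    (k i : nat) (p : {poly R}) :
  0 < theta -> (i + k < m)%N -> orthopoly w k p ->
  riesz (gauge rho theta v w) (gauge_orthopoly theta v k p * 'X^i) =
  rho^-1 * gauge_scale theta ^+ (i + k) * riesz w (p * ('X + v%:P) ^+ i).
Proof.
move=> t0 ikm [pk _]; rewrite riesz_gauge //.
  rewrite comp_polyM gauge_orthopolyK // comp_Xn_poly exprZn -scalerAl.
  by rewrite -scalerAr scalerA rieszZ -exprD addnC mulrA.
have sq : (size (gauge_orthopoly theta v k p) <= k.+1)%N.
  rewrite -[gauge_orthopoly _ _ _ _](subrK 'X^k).
  rewrite (leq_trans (size_polyD _ _)) // geq_max.
  by rewrite size_polyXn leqnn andbT ltnW // ltnS size_gauge_orthopoly.
rewrite (leq_trans (size_polyMleq _ _)) // size_polyXn; lia.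
Qed.

(** Pulled back, the test polynomial [X^i] is a multiple of [(X + v)^i], still of degree below
    [k]. *)
Lemma orthopoly_gauge (R : realType) (rho theta v : R) m (w : 'rV[R]_m)
    (k : nat) (p : {poly R}) :
  0 < theta -> (k.*2 <= m)%N -> orthopoly w k p ->
  orthopoly (gauge rho theta v w) k (gauge_orthopoly theta v k p).
Proof.
move=> t0 km po; split=> [|i ik].
  by case: po => pk _; apply: size_gauge_orthopoly.
rewrite riesz_gauge_orthopoly //; last by rewrite -addnn in km; lia.
rewrite (riesz_orthopoly_small po) ?mulr0 // -[v]opprK polyCN.
by rewrite size_exp_XsubC.
Qed.

(** * Transformation of the sigmas *)

Lemma sigma0_gauge (R : realType) (rho theta v : R) (m : nat) (w : 'rV[R]_m)
    (k : nat) :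
  0 < rho -> 0 < theta -> riesz_pos w k -> (k.*2 < m)%N ->
  sigma0 (gauge rho theta v w) k =
  rho^-1 * gauge_scale theta ^+ k.*2 * sigma0 w k.
Proof.
move=> rho_gt0 theta_gt0 wp km; have Gw := gramian_unit wp.
have Gw' : gramian (gauge rho theta v w) k \in unitmx.
  by apply: gramian_unit; apply: riesz_pos_gauge => //; lia.
have [p po] := orthopoly_exists Gw.
have po' := orthopoly_gauge rho v theta_gt0 (ltnW km) po.
rewrite (sigma0_orthopoly Gw' po') (sigma0_orthopoly Gw po).
rewrite riesz_gauge_orthopoly ?addnn //; congr (_ * _).
(* [(X + v)^k - X^k] has degree below [k], so it is orthogonal to [p]. *)
rewrite -[X in riesz w (_ * X)](subrK 'X^k) mulrDr linearD /=.
rewrite [X in X + _](riesz_orthopoly_small po) ?add0r //.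
by rewrite -[v]opprK polyCN size_XsubC_expB.
Qed.

Lemma sigma1_gauge (R : realType) (rho theta v : R) (m : nat) (w : 'rV[R]_m)
    (k : nat) :
  0 < rho -> 0 < theta -> riesz_pos w k -> (k.*2.+1 < m)%N ->
  sigma1 (gauge rho theta v w) k =
  rho^-1 * gauge_scale theta ^+ k.*2.+1 *
  (sigma1 w k + k.+1%:R * v * sigma0 w k).
Proof.
move=> rho_gt0 theta_gt0 wp km; have Gw := gramian_unit wp.
have Gw' : gramian (gauge rho theta v w) k \in unitmx.
  by apply: gramian_unit; apply: riesz_pos_gauge => //; lia.
have [p po] := orthopoly_exists Gw.
have po' := orthopoly_gauge rho v theta_gt0 (ltnW (ltnW km)) po.
rewrite (sigma1_orthopoly Gw' po') (sigma1_orthopoly Gw po).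
rewrite (sigma0_orthopoly Gw po).
rewrite riesz_gauge_orthopoly ?addSn ?addnn //; congr (_ * _).
(* The two leading terms of [(X + v)^(k+1)] give [sigma1] and the shift by [sigma0]; the remainder
   is orthogonal to [p]. *)
have [r rk ->] := expXDC v k; rewrite !mulrDr !linearD /= -scalerAr rieszZ.
by rewrite [X in _ + X](riesz_orthopoly_small po) ?addr0.
Qed.

(** * The closure relation and its invariance *)

Lemma riesz_pos_row_mx (R : realType) (m l k : nat) (u : 'rV[R]_m)
    (t : 'rV[R]_l) :
  (k.*2 <= m.+1)%N -> riesz_pos u k -> riesz_pos (row_mx u t) k.
Proof.
move=> km up q q0 qk; rewrite riesz_row_mx; first exact: up.
by rewrite (leq_trans (size_polyMleq _ _)) //; rewrite -addnn in km; lia.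
Qed.

(** Moving the first [gramform] of the closure to the left turns the last entry of [w] into a sigma.
    Here [n.+1] is half the order, so [n] plays the part of [n - 1] in the closure. *)
Lemma ext_gramian_closureP (R : realType) (n : nat) (chi : R)
    (w : 'rV[R]_(n.+1.*2.+1 + 1)) :
  rsubmx w 0 0 = ext_gramian_closure chi (lsubmx w) <->
  sigma1 w n.+1 = chi * (sigma0 w n.+1 / sigma0 w n) * sigma1 w n.
Proof.
have lw k : (k <= n.+1.*2)%N -> mom (lsubmx w) k = mom w k.
  by move=> kn; rewrite mom_lsubmx.
have -> : rsubmx w 0 0 = mom w (2 * n.+1).+1.
  rewrite mxE -mom_ord /= mul2n; congr (mom w _); lia.
have gE l k : (k <= l)%N -> (l + k <= n.+1.*2.+1)%N ->
    gramform (lsubmx w) l k = gramform w l k.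
  by move=> kl lkn; apply: eq_gramform => // i ilk; rewrite lw //; lia.
rewrite /ext_gramian_closure doubleK /= /sigma0 /sigma1.
rewrite !gE ?lw; try lia.
by split => [->|E]; [rewrite addrC addKr | rewrite -E addrC subrK].
Qed.

Theorem theorem6p2 (R : realType) (M : nat) (Meven : ~~ odd M)
    (Mge2 : (2 <= M)%N) :
  let n := M./2 in
  @gauge_invariant R M (@ext_gramian_closure R M (n.+1%:R / n%:R)).
Proof.
move=> n rho theta v rho0 theta0 u Ru t w w'.
have {Ru}up : riesz_pos u n.+1.
  by apply: realizable_riesz_pos => //; lia.
have [k Mk] : exists k, M = k.+1.*2.
  by exists n.-1; lia.
move: u up @w @w'; rewrite /n Mk doubleK => u up.
set w := row_mx _ _; set w' := gauge _ _ _ w.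
(* Squares of polynomials of size [k + 2] have degree at most [2k + 2 = M], so they do not involve
   the arbitrary entry [uM1]. *)
have wp : riesz_pos w k.+2 by apply: riesz_pos_row_mx.
have := ext_gramian_closureP (k.+2%:R / k.+1%:R) w.
rewrite {1 2}/w row_mxKl row_mxKr mxE => ->.
rewrite (ext_gramian_closureP _ w').
have wp1 := riesz_posW (leqnSn _) wp.
have wp0 := riesz_posW (leqnSn _) wp1.
have T0gt := sigma0_gt0 wp1.
rewrite /w' !sigma1_gauge ?sigma0_gauge //; try lia.
have := gauge_scale_gt0 theta0; set a := gauge_scale theta => a0.
have chiE : k.+2%:R / k.+1%:R * k.+1%:R = k.+2%:R :> R.
  by rewrite divfK // pnatr_eq0.
set S1 := sigma1 w k.+1; set S0 := sigma0 w k.+1.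
set T1 := sigma1 w k; set T0 := sigma0 w k.
have T0n : T0 != 0 by rewrite gt_eqF.
have c0 : rho^-1 * a ^+ k.+1.*2.+1 != 0.
  by rewrite mulf_neq0 ?invr_eq0 ?expf_neq0 ?gt_eqF.
(* The shift [(k+1) v T0] of [T1], multiplied by [chi S0 / T0], becomes [(k+2) v S0] by [chiE]:
   exactly the shift of [S1] on the other side. *)
have -> : k.+2%:R / k.+1%:R *
    (rho^-1 * a ^+ k.+1.*2 * S0 / (rho^-1 * a ^+ k.*2 * T0)) *
    (rho^-1 * a ^+ k.*2.+1 * (T1 + k.+1%:R * v * T0)) =
  rho^-1 * a ^+ k.+1.*2.+1 *
    (k.+2%:R / k.+1%:R * (S0 / T0) * T1 + k.+2%:R * v * S0).
  rewrite -chiE doubleS !exprS; field.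
  by rewrite T0n expf_neq0 ?gt_eqF //= nat1r pnatr_eq0.
(* Cancel the nonzero scale factor, then the common shift. *)
by split=> [/(mulfI c0)/addIr|->].
Qed.
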